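(* Let $S,T\subseteq\mathbb{F}_2^n$ be finite. Then $S$ and $T$ are affinely equivalent if and only if there exists an $(E(S),E(T))$-isomorphism $g:S\to T$.
   Context: $S,T$ are affinely equivalent if some affine automorphism $f$ of $\mathbb{F}_2^n$ satisfies $f(S)=T$. $E(S)$ is the collection of even-size subsets of $S$ whose elements sum to $\vec 0$ (including $\varnothing$); it is a linear subspace of the $\mathbb{F}_2$-vector space $\mathcal{P}(S)$ under symmetric difference. An $(E(S),E(T))$-isomorphism is a bijection $g:S\to T$ with $\{g(X):X\in E(S)\}=E(T)$. *)

(* Defs.v *)
From HB Require Import structures.
From mathcomp Require Import all_boot all_order all_algebra.

Set Implicit Arguments.
Unset Strict Implicit.
Unset Printing Implicit Defensive.

Import GRing.Theory.
Local Open Scope ring_scope.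

Definition affine_automorphism (n : nat)
    (f : 'rV['F_2]_n -> 'rV['F_2]_n) : Prop :=
  bijective f /\
  exists (L : {linear 'rV['F_2]_n -> 'rV['F_2]_n}) (b : 'rV['F_2]_n),
    forall x, f x = L x + b.

Definition affinely_equivalent (n : nat) (S T : {set 'rV['F_2]_n}) : Prop :=
  exists f : 'rV['F_2]_n -> 'rV['F_2]_n,
    affine_automorphism f /\ f @: S = T.

Definition E (n : nat) (S : {set 'rV['F_2]_n}) : {set {set 'rV['F_2]_n}} :=
  [set X in powerset S | ~~ odd #|X| & \sum_(x in X) x == 0].

(* The bijection g : S -> T is encoded as a total function on the ambient
   space that is injective on S with image T; its values outside S play no
   role, since every member of E S is a subset of S. *)
Definition E_isomorphism (n : nat) (S T : {set 'rV['F_2]_n})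
    (g : 'rV['F_2]_n -> 'rV['F_2]_n) : Prop :=
  [/\ {in S &, injective g}, g @: S = T
    & [set g @: X | X : {set 'rV['F_2]_n} in E S] = E T].

(* Main.v *)
Require Import Defs.
From mathcomp Require Import all_boot all_order all_algebra.

(** Fix [s0] in [S] and compare the two families of vectors [x - s0] and
    [g x - g s0], for [x] in [S].  Over F_2, a linear dependency of the first
    family is a subset of [S] which, up to toggling [s0], is a member of [E S];
    so [g] is an isomorphism exactly when both families satisfy the same linear
    dependencies, i.e. when an invertible linear map carries the first family
    to the second. *)

Set Implicit Arguments.
Unset Strict Implicit.
Unset Printing Implicit Defensive.

Import GRing.Theory.
Local Open Scope ring_scope.

(** The columns of [cokermx M^T], read as rows, lie in the left kernel of [M]; hence [N] kills them
    too. *)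
Lemma submx_tr_of_ker (F : fieldType) (m n p : nat)
    (M : 'M[F]_(m, n)) (N : 'M[F]_(m, p)) :
  (forall u : 'rV_m, u *m M = 0 -> u *m N = 0) -> (N^T <= M^T)%MS.
Proof.
move=> kerMN; rewrite submxE -trmx_eq0 trmx_mul trmxK; apply/eqP/row_matrixP=> i.
rewrite row0 row_mul; apply: kerMN.
rewrite -row_mul -[M in _ *m M]trmxK -trmx_mul.
by rewrite mulmx_coker trmx0 row0.
Qed.

(** Equal left kernels force equal column spaces, and matrices of the same size with equal column
    spaces differ by invertible column operations. *)
Lemma unitmx_of_ker_eq (F : fieldType) (m n : nat) (M N : 'M[F]_(m, n)) :
  (forall u : 'rV_m, u *m M = 0 <-> u *m N = 0) ->
  exists2 A : 'M_n, A \in unitmx & M *m A = N.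
Proof.
move=> kerMN.
have /eqmxMunitP[B uB defN] : (N^T == M^T)%MS.
  by apply/andP; split; apply: submx_tr_of_ker => u; case: (kerMN u).
exists B^T; first by rewrite unitmx_tr.
by rewrite -[M]trmxK -trmx_mul -defN trmxK.
Qed.

Section BinarySums.

Variables n : nat.
Local Notation V := 'rV['F_2]_n.
Implicit Types (S T X : {set V}) (h g : V -> V).

Lemma addvv (v : V) : v + v = 0.
Proof. by rewrite -mulr2n -scaler_nat pchar_Fp_0 // scale0r. Qed.

Lemma mulrn_odd (v : V) k : v *+ k = v *+ odd k.
Proof. by rewrite -{1}(odd_double_half k) mulrnDr -mul2n mulrnA mulr2n addvv mul0rn addr0. Qed.

Lemma in_E S X :
  (X \in E S) = [&& X \subset S, ~~ odd #|X| & \sum_(x in X) x == 0].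
Proof. by rewrite !inE. Qed.

(* Toggle [s0] in [X] when [X] has odd size. *)
Lemma even_completion S X s0 : s0 \in S -> X \subset S ->
  exists Y : {set V}, [/\ Y \subset S, ~~ odd #|Y|
    & forall h, \sum_(x in X) (h x - h s0) = \sum_(x in Y) h x].
Proof.
move=> Ss0 sXS.
have sumE h : \sum_(x in X) (h x - h s0) = \sum_(x in X) h x - h s0 *+ odd #|X|.
  by rewrite sumrB sumr_const -mulrn_odd.
have [oddX|evenX] := boolP (odd #|X|); last first.
  by exists X; split=> // h; rewrite sumE (negPf evenX) subr0.
have [Xs0|X's0] := boolP (s0 \in X).
  exists (X :\ s0); split.
  - exact: subset_trans (subD1set _ _) sXS.
  - by move: oddX; rewrite (cardsD1 s0) Xs0 /=.
  - by move=> h; rewrite sumE oddX mulr1n (big_setD1 s0) //= addrC addrK.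
exists (s0 |: X); split.
- by rewrite subUset sub1set Ss0.
- by rewrite cardsU1 X's0 /= oddX.
- move=> h; rewrite sumE oddX mulr1n big_setU1 //= addrC; congr (_ + _).
  by apply/eqP; rewrite eq_sym -subr_eq0 opprK addvv.
Qed.

(** Over F_2 a coefficient vector is the indicator of its support, so linear dependencies become
    vanishing subset sums. *)
Lemma mulmx_indicator S h (u : 'rV['F_2]_#|S|) :
  u *m (\matrix_i h (enum_val i)) =
  \sum_(x in [set enum_val i | i in [set i | u 0 i != 0]]) h x.
Proof.
rewrite mulmx_sum_row big_imset /=; last by move=> i j _ _; apply: enum_val_inj.
rewrite [RHS]big_mkcond /=; apply: eq_bigr => i _; rewrite inE rowK.
have [->|] := eqVneq (u 0 i) 0; first by rewrite scale0r.
case: (u 0 i) => [[|[|k]] lt_k] // _.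
by rewrite (_ : Ordinal lt_k = 1) ?scale1r //; apply: val_inj.
Qed.

Lemma sum_imset_E S T g X : E_isomorphism S T g ->
  X \subset S -> ~~ odd #|X| ->
  (\sum_(x in X) x = 0 <-> \sum_(x in X) g x = 0).
Proof.
case=> inj_g gS gE sXS evenX.
have injX : {in X &, injective g}.
  by move=> x y Xx Xy; apply: inj_g; apply: (subsetP sXS).
have gXE : (g @: X \in E T) = (\sum_(x in X) g x == 0).
  by rewrite in_E -gS imsetS // card_in_imset // evenX big_imset.
split=> [sumX | sumgX].
  by apply/eqP; rewrite -gXE -gE imset_f // in_E sXS evenX sumX eqxx.
(* The converse pulls [g @: X] back to some [Y] in [E S]; injectivity on [S] then forces [X = Y]. *)
have: g @: X \in E T by rewrite gXE sumgX.
rewrite -gE => /imsetP[Y]; rewrite in_E => /and3P[sYS _ /eqP sumY] gXY.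
suffices -> : X = Y by [].
apply/setP=> x; apply/idP/idP=> [Xx | Yx].
  have: g x \in g @: Y by rewrite -gXY imset_f.
  by case/imsetP=> y Yy /(inj_g _ _ (subsetP sXS _ Xx) (subsetP sYS _ Yy)) ->.
have: g x \in g @: X by rewrite gXY imset_f.
by case/imsetP=> y Xy /(inj_g _ _ (subsetP sYS _ Yx) (subsetP sXS _ Xy)) ->.
Qed.

(** Over an even set the translation [b] cancels, so the sum of the images is [L] of the sum, and
    [L] is injective. *)
Lemma E_isomorphism_affine S T f : affine_automorphism f -> f @: S = T ->
  E_isomorphism S T f.
Proof.
case=> bij_f [L [b fE]] fS; have inj_f := bij_inj bij_f.
have injL : injective L by move=> x y eqL; apply: inj_f; rewrite !fE eqL.
have fXE X : (f @: X \in E T) = (X \in E S).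
  rewrite !in_E -fS card_imset // big_imset /=; last by move=> ? ? _ _ /inj_f.
  rewrite (eq_bigr _ (fun x _ => fE x)) big_split /= -linear_sum sumr_const.
  have -> : (f @: X \subset f @: S) = (X \subset S).
    apply/idP/idP=> [/subsetP sXS | /imsetS->//].
    by apply/subsetP=> x Xx; rewrite -(mem_imset _ _ inj_f) sXS ?imset_f.
  case: (X \subset S) => //=; have [//|evenX /=] := boolP (odd _).
  by rewrite mulrn_odd (negPf evenX) addr0 raddf_eq0.
split=> //; first by move=> x y _ _ /inj_f.
apply/setP=> Y; apply/imsetP/idP => [[X ES ->] | ETY]; first by rewrite fXE.
have YE : f @: (f @^-1: Y) = Y.
  case: bij_f => f' _ f'K; apply/setP=> y; apply/imsetP/idP.
    by case=> x; rewrite inE => Yfx ->.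
  by move=> Yy; exists (f' y); rewrite ?inE f'K.
by exists (f @^-1: Y); rewrite // -fXE YE.
Qed.

Lemma affine_E_isomorphism S T g : E_isomorphism S T g ->
  affinely_equivalent S T.
Proof.
move=> iso_g; have [_ gS _] := iso_g.
(* Without a base point both sets are empty, and the identity works. *)
have [S0|[s0 Ss0]] := set_0Vmem S.
  exists id; split; last by rewrite -gS S0 !imset0.
  split; first by exists id.
  by exists idfun, 0 => x; rewrite addr0.
have [|A uA defA] := @unitmx_of_ker_eq _ _ _
  (\matrix_(i < #|S|) (enum_val i - s0)) (\matrix_i (g (enum_val i) - g s0)).
  move=> u; rewrite (mulmx_indicator (fun x => x - s0)).
  rewrite (mulmx_indicator (fun x => g x - g s0)).
  set X := [set _ | _ in _]; have sXS : X \subset S.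
    by apply/subsetP=> _ /imsetP[i _ ->]; apply: enum_valP.
  (* [Y] does not depend on [h]: the same even set serves [id] and [g]. *)
  have [Y [sYS evenY sumY]] := even_completion Ss0 sXS.
  by rewrite (sumY id) (sumY g); apply: sum_imset_E iso_g _ _.
have gE x : x \in S -> (x - s0) *m A = g x - g s0.
  move=> Sx; have /(congr1 (row (enum_rank_in Ss0 x))) := defA.
  by rewrite row_mul !rowK enum_rankK_in.
(* The translation is the one that sends [s0] to [g s0]. *)
exists (fun x => x *m A + (g s0 - s0 *m A)); split.
  split; last by exists (mulmxr A), (g s0 - s0 *m A).
  exists (fun y => (y - (g s0 - s0 *m A)) *m invmx A) => x.
    by rewrite addrK mulmxK.
  by rewrite mulmxKV // subrK.
rewrite -gS; apply: eq_in_imset => x Sx.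
by rewrite addrCA -mulmxBl gE // addrC subrK.
Qed.

End BinarySums.

Theorem theorem5p6 (n : nat) (S T : {set 'rV['F_2]_n}) :
  affinely_equivalent S T <->
  exists g : 'rV['F_2]_n -> 'rV['F_2]_n, E_isomorphism S T g.
Proof.
split=> [[f [aff_f fS]] | [g /affine_E_isomorphism //]].
by exists f; apply: E_isomorphism_affine.
Qed.
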